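(* Let $\mathcal{N}=\langle\mathcal{M}^+,a,b\rangle$ be a model of $\mathrm{LA}_2$ such that, for some non-standard element $L$ of it, there is a function $\cdot$ on $[0,L]^2$ that is definable in $\mathcal{N}$ and is a multiplication, i.e. satisfies $x\cdot 0=0$ and $x\cdot(y+1)=x\cdot y+x$. Let $\mathcal{A}=\langle M,0,+,-,\leq,r\rangle_{r\in R}$ be the discretely ordered module corresponding to $\mathcal{N}$. Then $\mathcal{A}$ is not NIP.
   Context: Linear arithmetic $\mathrm{LA}_2$ is the first-order theory in the language $\langle 0,1,+,\leq,a,b\rangle$, where $a,b$ are unary function symbols, with the following axioms (universally closed), where $s,t$ range over $\{a,b\}$: (A1) $0\neq z+1$; (A2) $x+1=y+1\rightarrow x=y$; (A3) $x+0=x$; (A4) $x+(y+1)=(x+y)+1$; (D$_\leq$) $x\leq y\leftrightarrow(\exists z)(x+z=y)$; (L1) $s(x+1)=s x+s 1$; (L2) $s(t x)=t(s x)$; (Ind) $\bigl(\varphi(0,\overline{y})\wedge(\forall x)(\varphi(x,\overline{y})\rightarrow\varphi(x+1,\overline{y}))\bigr)\rightarrow(\forall x)\varphi(x,\overline{y})$ for all formulas $\varphi(x,\overline{y})$ of the language. In a model $\mathcal{N}$ of $\mathrm{LA}_2$ all elements are non-negative; $\mathcal{M}^+$ denotes its reduct to $\langle 0,1,+,\leq\rangle$. The standard elements are $0,1,1+1,\dots$, i.e. the natural numbers; the other elements are non-standard. $[0,L]$ is the set of elements $x$ of $\mathcal{N}$ with $0\leq x\leq L$. The identities defining a multiplication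 on $[0,L]^2$ are required whenever all arguments of $\cdot$ lie in $[0,L]$. The discretely ordered module corresponding to $\mathcal{N}$ is obtained as follows. Formally add negative elements to $\mathcal{N}$, obtaining an ordered abelian group with universe $M$ (whose non-negative elements are the elements of $\mathcal{N}$), and extend $a,b$ to it additively. Then $M$ is a module over the polynomial ring $\mathbb{Z}[a,b]$. Put $R=\mathbb{Z}[a,b]/\mathrm{Ann}_{\mathbb{Z}[a,b]}(M)$, ordered via the map $[p]\mapsto p1\in M$. Then $M$ is an ordered module over the ordered ring $R$, with least positive element $1$. The structure $\mathcal{A}=\langle M,0,+,-,\leq,r\rangle_{r\in R}$ has a unary function symbol for scalar multiplication by each $r\in R$. A structure $\mathcal{A}$ with universe $A$ is NIP if there is no formula $\varphi(\overline{x},\overline{y})$ such that for every $n\in\omega$ there are $\overline{a_i}\in A^{l(\overline{x})}$ for $i<n$ and $\overline{b_J}\in A^{l(\overline{y})}$ for $J\subseteq n=\{0,\dots,n-1\}$ with $\mathcal{A}\models\varphi(\overline{a_i},\overline{b_J})\Leftrightarrow i\in J$ for all $i<n$, $J\subseteq n$ (here $l(\cdot)$ denotes the length of a tuple). *)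

(* Defs.v *)
From HB Require Import structures.
From mathcomp Require Import all_boot all_order all_algebra.
From mathcomp Require Import boolp.
From mathcomp.multinomials Require Import ssrcomplements mpoly.

Set Implicit Arguments.
Unset Strict Implicit.
Unset Printing Implicit Defensive.

Import Order.TTheory GRing.Theory.
Local Open Scope ring_scope.
Local Open Scope quotient_scope.

Record signature := Signature {
  fsym : Type; farity : fsym -> nat;
  rsym : Type; rarity : rsym -> nat
}.

Record structure (S : signature) := Structure {
  dom :> Type;
  fint : forall f : fsym S, (farity f).-tuple dom -> dom;
  rint : forall r : rsym S, (rarity r).-tuple dom -> Prop
}.

(* Terms and formulas are indexed by the number [n] of their free variables;
   inside a quantifier, variable 0 is the bound one. *)
Inductive term (S : signature) (n : nat) : Type :=
| Var of 'I_n
| Fun (f : fsym S) of ('I_(farity f) -> term S n).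

Inductive formula (S : signature) : nat -> Type :=
| Bot n : formula S n
| Eq n of term S n & term S n : formula S n
| Rel n (r : rsym S) of ('I_(rarity r) -> term S n) : formula S n
| And n of formula S n & formula S n : formula S n
| Or n of formula S n & formula S n : formula S n
| Imp n of formula S n & formula S n : formula S n
| All n of formula S n.+1 : formula S n
| Ex n of formula S n.+1 : formula S n.

Arguments Var {S n}.
Arguments Fun {S n}.
Arguments Bot {S n}.
Arguments Rel {S n}.

Fixpoint eval S (A : structure S) n (e : n.-tuple A) (t : term S n) : A :=
  match t with
  | Var i => tnth e i
  | Fun f args => fint [tuple eval e (args i) | i < farity f]
  end.

Fixpoint sat S (A : structure S) n (phi : formula S n) : n.-tuple A -> Prop :=
  match phi with
  | Bot _ => fun _ => False
  | Eq _ t u => fun e => eval e t = eval e u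
  | Rel _ r args => fun e => rint [tuple eval e (args i) | i < rarity r]
  | And _ p q => fun e => sat p e /\ sat q e
  | Or _ p q => fun e => sat p e \/ sat q e
  | Imp _ p q => fun e => sat p e -> sat q e
  | All _ p => fun e => forall x : A, sat p [tuple of x :: e]
  | Ex _ p => fun e => exists x : A, sat p [tuple of x :: e]
  end.

Definition definable S (A : structure S) k (X : k.-tuple A -> Prop) : Prop :=
  exists m (phi : formula S (k + m)) (c : m.-tuple A),
    forall t : k.-tuple A, sat phi [tuple of t ++ c] <-> X t.

Definition NIP S (A : structure S) : Prop :=
  ~ exists k l (phi : formula S (k + l)),
      forall n : nat,
        exists (a : 'I_n -> k.-tuple A) (b : {set 'I_n} -> l.-tuple A),
          forall (i : 'I_n) (J : {set 'I_n}),
            sat phi [tuple of a i ++ b J] <-> i \in J.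

Inductive ab := sym_a | sym_b.

Inductive la_fun := LZero | LOne | LAdd | LScal of ab.
Inductive la_rel := LLe.

Definition LA : signature := {|
  fsym := la_fun;
  farity f := match f with LZero | LOne => 0 | LAdd => 2 | LScal _ => 1 end;
  rsym := la_rel;
  rarity _ := 2
|}.

Section LAOperations.
Variable N : structure LA.

Definition la0 : N := @fint LA N LZero [tuple].
Definition la1 : N := @fint LA N LOne [tuple].
Definition laD (x y : N) : N := @fint LA N LAdd [tuple x; y].
Definition laS (s : ab) (x : N) : N := @fint LA N (LScal s) [tuple x].
Definition laLe (x y : N) : Prop := @rint LA N LLe [tuple x; y].

End LAOperations.

Arguments la0 {N}.
Arguments la1 {N}.

Declare Scope la_scope.
Delimit Scope la_scope with la.
Notation "0" := la0 : la_scope.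
Notation "1" := la1 : la_scope.
Notation "x + y" := (laD x y) : la_scope.
Notation "x <= y" := (laLe x y) : la_scope.

Record is_LA2 (N : structure LA) : Prop := IsLA2 {
  ax_A1 : forall z : N, 0%la <> (z + 1)%la;
  ax_A2 : forall x y : N, (x + 1 = y + 1)%la -> x = y;
  ax_A3 : forall x : N, (x + 0)%la = x;
  ax_A4 : forall x y : N, (x + (y + 1) = (x + y) + 1)%la;
  ax_Dle : forall x y : N, (x <= y)%la <-> exists z : N, (x + z)%la = y;
  ax_L1 : forall (s : ab) (x : N), (laS s (x + 1) = laS s x + laS s 1)%la;
  ax_L2 : forall (s t : ab) (x : N), laS s (laS t x) = laS t (laS s x);
  ax_Ind : forall n (phi : formula LA n.+1) (y : n.-tuple N),
    sat phi [tuple of 0%la :: y] ->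
    (forall x : N, sat phi [tuple of x :: y] ->
                   sat phi [tuple of (x + 1)%la :: y]) ->
    forall x : N, sat phi [tuple of x :: y]
}.

Record LA2_model := LA2Model {
  LA2_structure :> structure LA;
  LA2_axioms : is_LA2 LA2_structure
}.

Fixpoint numeral (N : structure LA) (n : nat) : N :=
  if n is n'.+1 then (numeral N n' + 1)%la else 0%la.

Definition standard (N : structure LA) (x : N) : Prop :=
  exists n : nat, x = numeral N n.

(* A function on [0,L]^2 is given by a total function [mul] whose values
   elsewhere are irrelevant, both here and in [definable_mult_upto]. *)
Definition is_mult_upto (N : structure LA) (L : N) (mul : N -> N -> N) : Prop :=
  (forall x : N, (x <= L)%la -> mul x 0%la = 0%la) /\
  (forall x y : N, (x <= L)%la -> (y <= L)%la -> (y + 1 <= L)%la ->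
     mul x (y + 1)%la = (mul x y + x)%la).

Definition definable_mult_upto (N : structure LA) (L : N)
    (mul : N -> N -> N) : Prop :=
  definable (fun t : 3.-tuple N => exists x y : N,
    [/\ (x <= L)%la, (y <= L)%la & t = [tuple x; y; mul x y]]).

Section Arithmetic.
Variable N : LA2_model.
Local Open Scope la_scope.
Implicit Types x y z : N.

Let tD n (t u : term LA n) : term LA n :=
  @Fun LA n LAdd (fun i => if val i == 0%N then t else u).
Let t0 n : term LA n :=
  @Fun LA n LZero (fun i : 'I_0 => False_rect _ (notF (ltn_ord i))).
Let t1 n : term LA n :=
  @Fun LA n LOne (fun i : 'I_0 => False_rect _ (notF (ltn_ord i))).
Let tS s n (t : term LA n) : term LA n := @Fun LA n (LScal s) (fun=> t).

Let evD n (e : n.-tuple N) t u : eval e (tD t u) = eval e t + eval e u.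
Proof.
rewrite /= /laD; congr (fint _); apply: eq_from_tnth => i.
by rewrite tnth_mktuple; case: i => -[|[|]].
Qed.

Let ev0 n (e : n.-tuple N) : eval e (t0 n) = 0.
Proof. by rewrite /= /la0; congr (fint _); apply: eq_from_tnth => -[]. Qed.

Let ev1 n (e : n.-tuple N) : eval e (t1 n) = 1.
Proof. by rewrite /= /la1; congr (fint _); apply: eq_from_tnth => -[]. Qed.

Let evS s n (e : n.-tuple N) t : eval e (tS s t) = laS s (eval e t).
Proof.
rewrite /= /laS; congr (fint _); apply: eq_from_tnth => i.
by rewrite tnth_mktuple; case: i => -[|].
Qed.

Let v0 n : term LA n.+1 := Var ord0.
Let v1 n : term LA n.+2 := Var (lift ord0 ord0).
Let v2 n : term LA n.+3 := Var (lift ord0 (lift ord0 ord0)).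

Let evv0 n (e : n.-tuple N) x : eval [tuple of x :: e] (v0 n) = x.
Proof. by []. Qed.
Let evv1 n (e : n.-tuple N) x y : eval [tuple of x :: y :: e] (v1 n) = y.
Proof. by []. Qed.
Let evv2 n (e : n.-tuple N) x y z :
  eval [tuple of x :: y :: z :: e] (v2 n) = z.
Proof. by []. Qed.

Let evE := (evD, ev0, ev1, evS, evv0, evv1, evv2).

Let ind n (phi : formula LA n.+1) (e : n.-tuple N) (P : N -> Prop) :
  (forall x, sat phi [tuple of x :: e] = P x) ->
  P 0 -> (forall x, P x -> P (x + 1)) -> forall x, P x.
Proof.
move=> phiP P0 PS x; rewrite -phiP; apply: (ax_Ind (LA2_axioms N)) => [|y].
  by rewrite phiP.
by rewrite !phiP; apply: PS.
Qed.

Let A2 := ax_A2 (LA2_axioms N).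
Let A3 := ax_A3 (LA2_axioms N).
Let A4 := ax_A4 (LA2_axioms N).

Lemma la_add0 x : 0 + x = x.
Proof.
elim/(@ind _ (Eq (tD (t0 _) (v0 0)) (v0 0)) [tuple]): x => [x||x IH].
- by cbn [sat]; rewrite !evE.
- by rewrite A3.
- by rewrite A4 IH.
Qed.

Lemma la_addA x y z : x + (y + z) = x + y + z.
Proof.
elim/(@ind _ (Eq (tD (v1 _) (tD (v2 0) (v0 _))) (tD (tD (v1 _) (v2 _)) (v0 _)))
  [tuple x; y]): z => [z||z IH].
- by cbn [sat]; rewrite !evE.
- by rewrite !A3.
- by rewrite !A4 IH.
Qed.

Lemma la_addS x y : (x + 1) + y = (x + y) + 1.
Proof.
elim/(@ind _ (Eq (tD (tD (v1 0) (t1 _)) (v0 _)) (tD (tD (v1 _) (v0 _)) (t1 _)))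
  [tuple x]): y => [y||y IH].
- by cbn [sat]; rewrite !evE.
- by rewrite !A3.
- by rewrite !A4 IH.
Qed.

Lemma la_addC x y : x + y = y + x.
Proof.
elim/(@ind _ (Eq (tD (v1 0) (v0 _)) (tD (v0 _) (v1 _))) [tuple x]): y
  => [y||y IH].
- by cbn [sat]; rewrite !evE.
- by rewrite A3 la_add0.
- by rewrite A4 IH la_addS.
Qed.

Lemma la_addI x y z : x + z = y + z -> x = y.
Proof.
elim/(@ind _ (Imp (Eq (tD (v1 1) (v0 _)) (tD (v2 _) (v0 _)))
                  (Eq (v1 _) (v2 _))) [tuple x; y]): z => [z||z IH].
- by cbn [sat]; rewrite !evE.
- by rewrite !A3.
- by rewrite !A4 => /A2.
Qed.

Lemma la_case x : x = 0 \/ exists y, x = y + 1.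
Proof.
elim/(@ind _ (Or (Eq (v0 0) (t0 _)) (Ex (Eq (v1 _) (tD (v0 _) (t1 _)))))
  [tuple]): x => [x||x _].
- cbn [sat]; rewrite !evE; congr (_ \/ _).
  by apply: eq_exists => y; rewrite !evE.
- by left.
- by right; exists x.
Qed.

Lemma la_add_eq0 x y : x + y = 0 -> x = 0.
Proof.
case: (la_case y) => [->|[z ->]]; first by rewrite A3.
by rewrite A4 => /esym /(ax_A1 (LA2_axioms N)).
Qed.

Lemma la_total x y : (exists z, x + z = y) \/ (exists z, y + z = x).
Proof.
elim/(@ind _ (Or (Ex (Eq (tD (v1 1) (v0 _)) (v2 _)))
                 (Ex (Eq (tD (v2 _) (v0 _)) (v1 _)))) [tuple y]): x
  => [x||x [][z]].
- by cbn [sat]; congr (_ \/ _); apply: eq_exists => z; rewrite !evE.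
- by left; exists y; rewrite la_add0.
- case: (la_case z) => [->|[w ->]].
    by rewrite A3 => ->; right; exists 1.
  by rewrite A4 => e; left; exists w; rewrite la_addS.
- by move=> <-; right; exists (z + 1); rewrite A4.
Qed.

Lemma la_scal0 s : laS s 0 = 0 :> N.
Proof.
have := ax_L1 (LA2_axioms N) s 0; rewrite la_add0 -{1}[laS s 1]la_add0.
by move/la_addI.
Qed.

Lemma la_scalD s x y : laS s (x + y) = laS s x + laS s y.
Proof.
elim/(@ind _ (Eq (tS s (tD (v1 0) (v0 _)))
                 (tD (tS s (v1 _)) (tS s (v0 _)))) [tuple x]): y
  => [y||y IH].
- by cbn [sat]; rewrite !evE.
- by rewrite la_scal0 !A3.
- by rewrite A4 !(ax_L1 (LA2_axioms N)) IH la_addA.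
Qed.

End Arithmetic.

(* Negative elements are added to [N] by taking formal differences: the pair
   [(x, y)] stands for [x - y]. *)
Section DifferenceGroup.
Variable N : LA2_model.
Local Notation pre := ({classic N} * {classic N})%type.

Definition diff_eq (u v : pre) : bool := `[< (u.1 + v.2 = v.1 + u.2)%la >].

Lemma diff_eq_equiv : equiv_class_of diff_eq.
Proof.
split=> [u|u v|v u w]; rewrite /diff_eq.
- exact/asboolP.
- by apply/asboolP/asboolP.
- move=> /asboolP uv /asboolP vw; apply/asboolP.
  apply: (@la_addI N _ _ v.2).
  rewrite -la_addA [(w.2 + _)%la]la_addC la_addA uv -la_addA.
  rewrite [(u.2 + _)%la]la_addC la_addA vw -!la_addA.
  by congr (_ + _)%la; apply: la_addC.
Qed.

Canonical diff_equiv := EquivRelPack diff_eq_equiv.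
Canonical diff_encModRel := defaultEncModRel diff_eq.

Definition diffgrp : Type := {eq_quot diff_eq}.

HB.instance Definition _ := Choice.on diffgrp.
HB.instance Definition _ : EqQuotient pre diff_eq diffgrp :=
  EqQuotient.on diffgrp.

Definition diff (x y : N) : diffgrp := \pi_diffgrp (x, y).
Definition inj (x : N) : diffgrp := diff x 0%la.
Definition fstr (u : diffgrp) : N := (repr u).1.
Definition sndr (u : diffgrp) : N := (repr u).2.

Lemma diffP x y x' y' :
  diff x y = diff x' y' <-> (x + y' = x' + y)%la.
Proof.
split=> [/eqmodP|h]; first by move=> /asboolP.
by apply/eqmodP/asboolP.
Qed.

Lemma diff_repr u : diff (fstr u) (sndr u) = u.
Proof. by rewrite /diff /fstr /sndr -surjective_pairing reprK. Qed.

Lemma repr_diff x y :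
  (fstr (diff x y) + y = x + sndr (diff x y))%la.
Proof. by apply/diffP; rewrite diff_repr. Qed.

Lemma diff_ind (P : diffgrp -> Prop) :
  (forall x y, P (diff x y)) -> forall u, P u.
Proof. by move=> h u; rewrite -(diff_repr u). Qed.

Definition dzero : diffgrp := inj 0%la.
Definition dopp (u : diffgrp) := diff (sndr u) (fstr u).
Definition dadd (u v : diffgrp) :=
  diff (fstr u + fstr v)%la (sndr u + sndr v)%la.

Lemma la_addACA (x y z w : N) : (x + y + (z + w) = x + z + (y + w))%la.
Proof.
rewrite -!la_addA; congr (_ + _)%la.
by rewrite !la_addA; congr (_ + _)%la; apply: la_addC.
Qed.

Lemma dopp_diff x y : dopp (diff x y) = diff y x.
Proof.
by apply/diffP; rewrite la_addC -repr_diff la_addC.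
Qed.

Lemma dadd_diff x y x' y' :
  dadd (diff x y) (diff x' y') = diff (x + x')%la (y + y')%la.
Proof.
by apply/diffP; rewrite la_addACA !repr_diff la_addACA.
Qed.

Lemma daddA : associative dadd.
Proof.
elim/diff_ind=> x y; elim/diff_ind=> z t; elim/diff_ind=> v w.
by rewrite !dadd_diff !la_addA.
Qed.

Lemma daddC : commutative dadd.
Proof.
elim/diff_ind=> x y; elim/diff_ind=> z t.
by rewrite !dadd_diff; congr diff; apply: la_addC.
Qed.

Lemma dadd0 : left_id dzero dadd.
Proof. by elim/diff_ind=> x y; rewrite dadd_diff !la_add0. Qed.

Lemma daddN : left_inverse dzero dopp dadd.
Proof.
elim/diff_ind=> x y; rewrite dopp_diff dadd_diff; apply/diffP.
by rewrite la_add0 (ax_A3 (LA2_axioms N)) la_addC.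
Qed.

HB.instance Definition _ :=
  GRing.isZmodule.Build diffgrp daddA daddC dadd0 daddN.

Lemma diffD x y x' y' :
  diff x y + diff x' y' = diff (x + x')%la (y + y')%la.
Proof. exact: dadd_diff. Qed.

Lemma diffN x y : - diff x y = diff y x.
Proof. exact: dopp_diff. Qed.

Lemma inj0 : inj 0%la = 0.
Proof. by []. Qed.

Lemma injD x y : inj (x + y)%la = inj x + inj y.
Proof. by rewrite diffD la_add0. Qed.

Lemma inj_injective : injective inj.
Proof. by move=> x y /diffP; rewrite !(ax_A3 (LA2_axioms N)). Qed.

Lemma diffE x y : diff x y = inj x - inj y.
Proof. by rewrite diffN diffD la_add0 (ax_A3 (LA2_axioms N)). Qed.

(* The order is the one whose non-negative elements are those of [N]. *)
Definition dle (u v : diffgrp) : bool := `[< exists z : N, v - u = inj z >].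

Lemma dle_anti : antisymmetric dle.
Proof.
move=> u v /andP[/asboolP[z vu] /asboolP[w uv]].
have : inj (z + w)%la = inj 0%la by rewrite injD -vu -uv addrA subrK subrr.
move=> /inj_injective /la_add_eq0 z0; apply/esym/eqP.
by rewrite -subr_eq0 vu z0.
Qed.

Lemma dle_trans : transitive dle.
Proof.
move=> v u w /asboolP[z vu] /asboolP[t wv]; apply/asboolP.
by exists (t + z)%la; rewrite injD -vu -wv addrA subrK.
Qed.

Lemma dle_refl : reflexive dle.
Proof. by move=> u; apply/asboolP; exists 0%la; rewrite subrr. Qed.

Lemma dle_total : total dle.
Proof.
move=> u v; suff: forall w : diffgrp, dle 0 w \/ dle 0 (- w).
  case/(_ (v - u)) => /asboolP; rewrite subr0 => -[z e].
    by apply/orP; left; apply/asboolP; exists z.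
  by apply/orP; right; apply/asboolP; exists z; rewrite -e opprB.
elim/diff_ind=> x y; case: (la_total x y) => -[z <-].
  right; apply/asboolP; exists z; rewrite subr0 diffN; apply/diffP.
  by rewrite (ax_A3 (LA2_axioms N)) la_addC.
left; apply/asboolP; exists z; rewrite subr0; apply/diffP.
by rewrite (ax_A3 (LA2_axioms N)) la_addC.
Qed.

HB.instance Definition _ := Order.Le_isPOrder.Build ring_display diffgrp
  dle_refl dle_anti dle_trans.
HB.instance Definition _ :=
  Order.POrder_isTotal.Build ring_display diffgrp dle_total.

Lemma dleP (u v : diffgrp) : reflect (exists z : N, v - u = inj z) (u <= v).
Proof. exact: asboolP. Qed.

Lemma dle0P (u : diffgrp) : (0 <= u) <-> exists z : N, u = inj z.
Proof.
by split=> [/dleP[z]|[z ->]]; first rewrite subr0 => ->; [exists z|];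
  last by apply/dleP; exists z; rewrite subr0.
Qed.

Lemma dleD2r (w u v : diffgrp) : (u + w <= v + w) = (u <= v).
Proof.
by apply/dleP/dleP => -[z e]; exists z; rewrite -e opprD addrACA subrr addr0.
Qed.

Lemma inj_le x y : (inj x <= inj y) <-> (x <= y)%la.
Proof.
split=> [/dleP[z /(canRL (subrK _))]|/(ax_Dle (LA2_axioms N))[z <-]].
  rewrite -injD => /inj_injective ->; apply/(ax_Dle (LA2_axioms N)).
  by exists z; rewrite la_addC.
by apply/dleP; exists z; rewrite injD addrC addKr.
Qed.

Lemma least_positive (u : diffgrp) : (0 < u) = (inj 1%la <= u).
Proof.
have one_ge0 : 0 <= inj 1%la by apply/dle0P; exists 1%la.
have one_neq0 : inj 1%la != 0.
  apply/eqP; rewrite -inj0 => /inj_injective.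
  by rewrite -[1%la]la_add0 => /esym /(ax_A1 (LA2_axioms N)).
apply/idP/idP; last by apply: lt_le_trans; rewrite lt_def one_neq0.
move=> u_gt0; have /dle0P[z e] := ltW u_gt0; move: u_gt0; rewrite {}e.
case: (la_case z) => [->|[y ->]].
  by rewrite inj0 ltxx.
by move=> _; apply/dleP; exists y; rewrite injD addrK.
Qed.

Definition dscal (s : ab) (u : diffgrp) : diffgrp :=
  diff (laS s (fstr u)) (laS s (sndr u)).

Lemma dscal_diff s x y : dscal s (diff x y) = diff (laS s x) (laS s y).
Proof. by apply/diffP; rewrite -!la_scalD repr_diff. Qed.

Lemma dscal_inj s x : dscal s (inj x) = inj (laS s x).
Proof. by rewrite dscal_diff la_scal0. Qed.

Lemma dscalB s : zmod_morphism (dscal s).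
Proof.
elim/diff_ind=> x y; elim/diff_ind=> z t.
by rewrite diffN diffD !dscal_diff diffN diffD !la_scalD.
Qed.

HB.instance Definition _ s :=
  GRing.isZmodMorphism.Build diffgrp diffgrp (dscal s) (dscalB s).

Lemma dscalC s t u : dscal s (dscal t u) = dscal t (dscal s u).
Proof.
by elim/diff_ind: u => x y; rewrite !dscal_diff !(ax_L2 (LA2_axioms N) s t).
Qed.

(* The monomial 'X_0^i 'X_1^j acts as a^i b^j. *)
Definition mon_act (m : 'X_{1..2}) (u : diffgrp) : diffgrp :=
  iter (m ord0) (dscal sym_a) (iter (m ord_max) (dscal sym_b) u).

Definition poly_act (p : {mpoly int[2]}) (u : diffgrp) : diffgrp :=
  \sum_(m <- msupp p) mon_act m u *~ p@_m.

Let iterB s k : zmod_morphism (iter k (dscal s)).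
Proof. by elim: k => [|k IH] u v //=; rewrite IH raddfB. Qed.

Lemma mon_actB m : zmod_morphism (mon_act m).
Proof. by move=> u v; rewrite /mon_act !iterB. Qed.

HB.instance Definition _ m :=
  GRing.isZmodMorphism.Build diffgrp diffgrp (mon_act m) (mon_actB m).

Lemma mon_actD m1 m2 u :
  mon_act m1 (mon_act m2 u) = mon_act (m1 + m2)%MM u.
Proof.
rewrite /mon_act !mnmDE !iterD; congr iter.
elim: (m1 ord_max) => [//|j IH] /=; rewrite IH.
by elim: (m2 ord0) => [//|i IHi] /=; rewrite -IHi dscalC.
Qed.

Lemma poly_actE k p u : (msize p <= k)%N ->
  poly_act p u = \sum_(m : 'X_{1..2 < k}) mon_act m u *~ p@_m.
Proof.
move=> le_pk; set I : subFinType _ := 'X_{1..2 < k}.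
rewrite /poly_act (big_mksub I) ?msupp_uniq //=; first last.
  by move=> m /msize_mdeg_lt /leq_trans; apply.
by rewrite big_rmcond //= => j /memN_msupp_eq0 ->; rewrite mulr0z.
Qed.

Lemma poly_actDl u : {morph poly_act^~ u : p q / p + q}.
Proof.
move=> p q /=; pose k := maxn (msize (p + q)) (maxn (msize p) (msize q)).
rewrite !(@poly_actE k) ?leq_max ?leqnn ?orbT // -big_split /=.
by apply: eq_bigr => m _; rewrite mcoeffD mulrzDr.
Qed.

Lemma poly_actDr : right_distributive poly_act +%R.
Proof.
move=> p u v; rewrite /poly_act -big_split /=.
by apply: eq_bigr => m _; rewrite raddfD mulrzDl.
Qed.

Lemma poly_act0 u : poly_act 0 u = 0.
Proof. by rewrite /poly_act msupp0 big_nil. Qed.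

Lemma poly_actZX c m u : poly_act (c *: 'X_[m]) u = mon_act m u *~ c.
Proof.
have [->|c0] := eqVneq c 0; first by rewrite scale0r poly_act0 mulr0z.
rewrite /poly_act (perm_big _ (msuppZ _ c0)) msuppX big_seq1.
by rewrite mcoeffZ mcoeffX eqxx mulr1.
Qed.

Lemma poly_act_sum I (r : seq I) (F : I -> {mpoly int[2]}) u :
  poly_act (\sum_(i <- r) F i) u = \sum_(i <- r) poly_act (F i) u.
Proof.
by elim/big_rec2: _ => [|i x p _ <-]; rewrite ?poly_act0 ?poly_actDl.
Qed.

Lemma poly_act1 : left_id 1 poly_act.
Proof.
by move=> u; rewrite -mpolyX0 -[_ 0%MM]scale1r poly_actZX /mon_act !mnm0E.
Qed.

Lemma poly_actA p q u : poly_act p (poly_act q u) = poly_act (p * q) u.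
Proof.
have ZXA c m v : poly_act (c *: 'X_[m]) (poly_act q v) =
                 poly_act (c *: 'X_[m] * q) v.
  rewrite poly_actZX {1}/poly_act raddf_sum /= [in RHS](mpolyE q) mulr_sumr.
  rewrite poly_act_sum mulrz_suml; apply: eq_bigr => m' _.
  rewrite -scalerAr -scalerAl scalerA -mpolyXD poly_actZX raddfMz.
  by rewrite /= mon_actD -mulrzA.
rewrite [in RHS](mpolyE p) mulr_suml poly_act_sum.
rewrite [in LHS](mpolyE p) poly_act_sum.
by apply: eq_bigr => m _; apply: ZXA.
Qed.

HB.instance Definition _ := GRing.Zmodule_isLmodule.Build {mpoly int[2]} diffgrp
  poly_actA poly_act1 poly_actDr poly_actDl.

Definition annM : {pred {mpoly int[2]}} :=
  fun p => `[< forall u : diffgrp, p *: u = 0 >].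

Lemma annM_idealr : idealr_closed annM.
Proof.
split.
- by apply/asboolP => u; rewrite scale0r.
- apply/asboolP => /(_ (inj 1%la)); rewrite scale1r -inj0 => /inj_injective.
  by rewrite -[1%la]la_add0 => /esym /(ax_A1 (LA2_axioms N)).
- move=> p q r /asboolP q0 /asboolP r0; apply/asboolP => u.
  by rewrite scalerDl -scalerA q0 scaler0 r0 addr0.
Qed.

HB.instance Definition _ := isIdealr.Build {mpoly int[2]} annM annM_idealr.

Definition scalring : comNzRingType := {ideal_quot annM}.

Definition rscale (r : scalring) (u : diffgrp) : diffgrp := repr r *: u.

Lemma rscale_pi (p : {mpoly int[2]}) u : rscale (\pi_scalring p) u = p *: u.
Proof.
rewrite /rscale; apply/eqP; rewrite -subr_eq0 -scalerBl.
have /asboolP -> // : repr (\pi_scalring p) - p \in annM.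
by rewrite Quotient.idealrBE reprK.
Qed.

End DifferenceGroup.

(* The order on the ring of scalars plays no role in this language. *)
Inductive mod_fun (R : Type) := MZero | MAdd | MOpp | MScal of R.
Inductive mod_rel := MLe.

Arguments MZero {R}.
Arguments MAdd {R}.
Arguments MOpp {R}.

Definition ordmod (R : Type) : signature := {|
  fsym := mod_fun R;
  farity f := match f with MZero => 0 | MAdd => 2 | MOpp | MScal _ => 1 end;
  rsym := mod_rel;
  rarity _ := 2
|}.

Definition ordered_module (N : LA2_model) : structure (ordmod (scalring N)) :=
  @Structure (ordmod (scalring N)) (diffgrp N)
    (fun f =>
       match f return (@farity (ordmod (scalring N)) f).-tuple (diffgrp N) ->
                      diffgrp N with
       | MZero => fun _ => 0
       | MAdd => fun v => tnth v ord0 + tnth v ord_max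
       | MOpp => fun v => - tnth v ord0
       | MScal r => fun v => rscale r (tnth v ord0)
       end)
    (fun _ v => tnth v ord0 <= tnth v ord_max).

(* Main.v *)
(** The scalars [a], [b], the parameter [1] and the formula [0 <= x] interpret
    [N] in the module, so an independent formula of [N] yields one of the
    module.  In [N], divisibility is independent: since [L] is non-standard,
    all standard numbers lie below [L], and there [mul] is true multiplication;
    take [a_i] to be the [i]-th of [n] distinct primes and [b_J] the product of
    those with index in [J]. *)
From mathcomp Require Import all_boot all_order all_algebra.
From mathcomp.multinomials Require Import mpoly.
Require Import Defs.

Set Implicit Arguments.
Unset Strict Implicit.
Unset Printing Implicit Defensive.

Import GRing.Theory.

(** * Interpretation of [N] in its module *)

Section Translation.
Variable N : LA2_model.
Local Notation M := (ordered_module N).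
Local Notation ordmodN := (ordmod (scalring N)).

Definition scalar_of (s : ab) : scalring N :=
  (\pi_(scalring N) 'X_(if s is sym_a then ord0 else ord_max))%qT.

Lemma rscale_scalar_of s (u : diffgrp N) : rscale (scalar_of s) u = dscal s u.
Proof.
rewrite /scalar_of rscale_pi -[X in GRing.scale X _]scale1r.
rewrite [LHS]poly_actZX mulr1z /mon_act.
by case: s; rewrite !mnm1E.
Qed.

(* [f] renames the free variables; [o] is a variable standing for [1]. *)
Fixpoint trans_term n p (f : 'I_n -> 'I_p) (o : 'I_p) (t : term LA n) :
    term ordmodN p :=
  match t with
  | Var i => Var (f i)
  | Fun g args =>
      match g return ('I_(@farity LA g) -> term ordmodN p) -> term ordmodN p
      with
      | LZero => @Fun ordmodN p MZero
      | LOne => fun=> Var o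
      | LAdd => @Fun ordmodN p MAdd
      | LScal s => @Fun ordmodN p (MScal (scalar_of s))
      end (fun i => trans_term f o (args i))
  end.

Definition lift_ren n p (f : 'I_n -> 'I_p) (i : 'I_n.+1) : 'I_p.+1 :=
  if unlift ord0 i is Some j then lift ord0 (f j) else ord0.

(** This formula cuts out the image of [N] in the module. *)
Definition nonneg_var0 p : formula ordmodN p.+1 :=
  @Rel ordmodN p.+1 MLe
    (fun i => if val i == 0 then @Fun ordmodN p.+1 MZero (fun=> Var ord0)
              else Var ord0).

(** Quantifiers are relativized to the non-negative elements. The target context [p] is independent
    of [n], which leaves room for the variable holding [1]. *)
Fixpoint trans n (phi : formula LA n) p :
    ('I_n -> 'I_p) -> 'I_p -> formula ordmodN p :=
  match phi with
  | Bot _ => fun _ _ => Bot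
  | Eq _ t u => fun f o => Eq (trans_term f o t) (trans_term f o u)
  | Rel _ LLe args =>
      fun f o => @Rel ordmodN p MLe (fun i => trans_term f o (args i))
  | And _ q r => fun f o => And (trans q f o) (trans r f o)
  | Or _ q r => fun f o => Or (trans q f o) (trans r f o)
  | Imp _ q r => fun f o => Imp (trans q f o) (trans r f o)
  | All _ q => fun f o =>
      All (Imp (nonneg_var0 p) (trans q (lift_ren f) (lift ord0 o)))
  | Ex _ q => fun f o =>
      Ex (And (nonneg_var0 p) (trans q (lift_ren f) (lift ord0 o)))
  end.

Lemma tuple2_eta (T : Type) (v : 2.-tuple T) :
  v = [tuple tnth v ord0; tnth v ord_max].
Proof.
by apply: eq_from_tnth => -[[|[|]]] // lti; congr tnth; apply: val_inj.
Qed.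

Lemma tuple1_eta (T : Type) (v : 1.-tuple T) : v = [tuple tnth v ord0].
Proof. by apply: eq_from_tnth => i; rewrite ord1. Qed.

Lemma eval_trans_term n p (f : 'I_n -> 'I_p) o (e : n.-tuple N)
    (e' : p.-tuple M) t :
  (forall i, tnth e' (f i) = inj (tnth e i)) -> tnth e' o = inj 1%la ->
  eval e' (trans_term f o t) = inj (eval e t).
Proof.
move=> ef eo; elim: t => [i|g args IH]; first exact: ef.
case: g args IH => [||  |s] args IH /=.
- by rewrite -inj0; congr inj; congr fint; apply: eq_from_tnth => -[].
- by rewrite eo; congr inj; congr fint; apply: eq_from_tnth => -[].
- by rewrite !tnth_mktuple !IH -injD [X in fint X]tuple2_eta !tnth_mktuple.
- rewrite !tnth_mktuple !IH rscale_scalar_of dscal_inj.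
  by rewrite [X in fint X]tuple1_eta tnth_mktuple.
Qed.

Lemma sat_nonneg_var0 p (e : p.-tuple M) (u : M) :
  sat (nonneg_var0 p) [tuple of u :: e] <-> exists x : N, u = inj x.
Proof. by rewrite /= !tnth_mktuple; apply: dle0P. Qed.

Lemma tnth_lift_ren n p (f : 'I_n -> 'I_p) (e : n.-tuple N) (e' : p.-tuple M)
    (x : N) :
  (forall i, tnth e' (f i) = inj (tnth e i)) ->
  forall i, tnth [tuple of (inj x : M) :: e'] (lift_ren f i)
            = inj (tnth [tuple of x :: e] i).
Proof.
move=> ef i; rewrite /lift_ren; case: unliftP => [j|] ->; last by [].
by rewrite !tnthS.
Qed.

(** Truth is preserved because [inj] is injective, preserves and reflects the order, and maps onto
    the non-negative elements over which the translated quantifiers range. *)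
Lemma sat_trans n (phi : formula LA n) p (f : 'I_n -> 'I_p) o
    (e : n.-tuple N) (e' : p.-tuple M) :
  (forall i, tnth e' (f i) = inj (tnth e i)) -> tnth e' o = inj 1%la ->
  sat (trans phi f o) e' <-> sat phi e.
Proof.
elim: phi p f o e e' => {n}
  [n|n t u|n [] args|n q IHq r IHr|n q IHq r IHr|n q IHq r IHr|n q IH|n q IH]
  p f o e e' ef eo.
- by [].
- rewrite /= !(eval_trans_term _ ef eo).
  by split=> [/inj_injective|->].
- rewrite /= !tnth_mktuple !(eval_trans_term _ ef eo) [X in rint X]tuple2_eta.
  by rewrite !tnth_mktuple; apply: inj_le.
- by rewrite /= (IHq _ _ _ _ _ ef eo) (IHr _ _ _ _ _ ef eo).
- by rewrite /= (IHq _ _ _ _ _ ef eo) (IHr _ _ _ _ _ ef eo).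
- by rewrite /= (IHq _ _ _ _ _ ef eo) (IHr _ _ _ _ _ ef eo).
- have IHx x : sat (trans q (lift_ren f) (lift ord0 o))
                 [tuple of (inj x : M) :: e'] <-> sat q [tuple of x :: e].
    by apply: IH; [apply: tnth_lift_ren | rewrite tnthS].
  split=> [h x|h u /sat_nonneg_var0[x ->]]; last exact/IHx.
  by apply/IHx/h/sat_nonneg_var0; exists x.
- have IHx x : sat (trans q (lift_ren f) (lift ord0 o))
                 [tuple of (inj x : M) :: e'] <-> sat q [tuple of x :: e].
    by apply: IH; [apply: tnth_lift_ren | rewrite tnthS].
  split=> [[u [/sat_nonneg_var0[x ->] /IHx h]]|[x /IHx h]]; first by exists x.
  by exists (inj x); split=> //; apply/sat_nonneg_var0; exists x.
Qed.

Lemma NIP_ordered_module : NIP M -> NIP N.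
Proof.
move=> nipM [k [l [phi indep]]]; apply: nipM.
(* The last of the [l + 1] parameter variables is reserved for [inj 1%la]. *)
pose f (i : 'I_(k + l)) : 'I_(k + (l + 1)) :=
  match split i with
  | inl j => lshift _ j
  | inr j => rshift k (lshift 1 j)
  end.
exists k, (l + 1), (trans phi f (rshift k (rshift l ord0))) => n.
have [a [b ab]] := indep n.
exists (fun i => map_tuple (@inj N) (a i)).
exists (fun J => [tuple of map_tuple (@inj N) (b J) ++ [tuple inj 1%la]]).
move=> i J; rewrite -ab; apply: sat_trans => [h|]; last first.
  by rewrite !tnth_rshift.
rewrite /f; case: split_ordP => j ->.
  by rewrite !tnth_lshift tnth_map.
by rewrite !tnth_rshift tnth_lshift tnth_map.
Qed.

End Translation.

(** * Standard elements and multiplication below [L] *)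

Section StandardPart.
Variable N : LA2_model.
Local Notation num := (numeral N).
Local Open Scope la_scope.

Lemma numeral_inj : injective num.
Proof.
elim=> [|i IH] [|j] //=.
- by move/(ax_A1 (LA2_axioms N)).
- by move/esym/(ax_A1 (LA2_axioms N)).
- by move/(ax_A2 (LA2_axioms N))/IH->.
Qed.

Lemma numeralD i j : num (i + j)%N = num i + num j.
Proof.
elim: j => [|j IH]; first by rewrite addn0 (ax_A3 (LA2_axioms N)).
by rewrite addnS /= IH (ax_A4 (LA2_axioms N)).
Qed.

(** The induction is on the natural number [k], not by the scheme of [N], as standardness need not
    be definable. Thus the standard elements form an initial segment. *)
Lemma standard_addl (x y : N) k : x + y = num k -> standard x.
Proof.
elim: k x y => [|k IH] x y /=.
  by move/la_add_eq0=> ->; exists 0%N.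
case: (la_case y) => [->|[w ->]].
  by rewrite (ax_A3 (LA2_axioms N)) => ->; exists k.+1.
by rewrite (ax_A4 (LA2_axioms N)) => /(ax_A2 (LA2_axioms N))/IH.
Qed.

Variables (L : N) (mul : N -> N -> N).
Hypothesis L_nonstd : ~ standard L.
Hypothesis mulL : is_mult_upto L mul.

(** By totality, the alternative is [L + z = num k], which would make [L] standard. *)
Lemma numeral_le k : num k <= L.
Proof.
apply/(ax_Dle (LA2_axioms N)).
by case: (la_total (num k) L) => // -[z /standard_addl].
Qed.

Lemma mul_numeralS z k : z <= L -> mul z (num k.+1) = mul z (num k) + z.
Proof.
move=> zL; apply: mulL.2 => //; first exact: numeral_le.
exact: (numeral_le k.+1).
Qed.

Lemma mul_numeral q p : mul (num q) (num p) = num (q * p)%N.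
Proof.
elim: p => [|p IH]; first by rewrite muln0 mulL.1 //; apply: numeral_le.
by rewrite mul_numeralS ?IH -?numeralD -?mulnSr //; apply: numeral_le.
Qed.

Lemma mul_numeral_dvdn p m : (0 < p)%N ->
  (exists2 z, z <= L & mul z (num p) = num m) <-> (p %| m)%N.
Proof.
case: p => // p _; split=> [[z zL e]|/dvdnP[q ->]]; last first.
  by exists (num q); [exact: numeral_le | rewrite mul_numeral].
(* The second factor is a successor, so [z] is a summand of [num m]; this excludes non-standard
   witnesses in [0, L]. *)
have [q zq] : standard z.
  by move: e; rewrite mul_numeralS // la_addC => /standard_addl.
by move: e; rewrite zq mul_numeral => /numeral_inj <-; apply: dvdn_mull.
Qed.

End StandardPart.

(** * Distinct primes and divisors of their products *)

Lemma prime_sequence :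
  exists q : nat -> nat, injective q /\ forall i, prime (q i).
Proof.
pose next m := s2val (prime_above m).
(* With [i.+1] iterations [q 0] is already a prime, not the seed [0]. *)
pose q i := iter i.+1 next 0.
have q_incr : {homo q : i j / i < j}.
  apply: homo_ltn => [i j k|i]; first exact: ltn_trans.
  exact: (s2valP (prime_above (q i))).
exists q; split=> [|i]; last exact: (s2valP' (prime_above (iter i next 0))).
exact: incn_inj (leq_mono q_incr).
Qed.

(** By Euclid's lemma a prime dividing the product divides, hence equals, some factor; injectivity
    of [q] then identifies the index. *)
Lemma prime_dvdn_prod (q : nat -> nat) n (i : 'I_n) (J : {set 'I_n}) :
  injective q -> (forall i, prime (q i)) ->
  (q i %| \prod_(j in J) q j) = (i \in J).
Proof.
move=> q_inj q_pr; apply/idP/idP => [|iJ]; last first.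
  by rewrite (bigD1 i) //= dvdn_mulr.
rewrite Euclid_dvd_prod // big_orE => /existsP[j /andP[jJ]].
by rewrite dvdn_prime2 // => /eqP/q_inj/val_inj ->.
Qed.

Theorem proposition4p1 (N : LA2_model) (L : N) (mul : N -> N -> N) :
  ~ standard L ->
  is_mult_upto L mul ->
  definable_mult_upto L mul ->
  ~ NIP (ordered_module N).
Proof.
move=> L_nonstd mulL [m [phi [c phiP]]] /NIP_ordered_module; apply.
have [q [q_inj q_pr]] := prime_sequence.
(* The divisor is the second factor: a product with a standard second factor
   is an iterated sum, so the first factor of a standard product is standard. *)
exists 1, m.+1, (Ex phi) => n.
exists (fun i => [tuple numeral N (q i)]).
exists (fun J : {set 'I_n} =>
  [tuple of numeral N (\prod_(j in J) q j) :: c]) => i J.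
rewrite -(prime_dvdn_prod i J q_inj q_pr).
rewrite -(mul_numeral_dvdn L_nonstd mulL _ (prime_gt0 (q_pr i))) /=.
(* [phi] defines the graph of [mul] and [Ex] binds its first coordinate, so the bound variable is
   the candidate quotient. *)
have phi_z z : sat phi [tuple of z ::
    [tuple of [tuple numeral N (q i)]
      ++ [tuple of numeral N (\prod_(j in J) q j) :: c]]] <->
    (z <= L)%la /\ mul z (numeral N (q i)) = numeral N (\prod_(j in J) q j).
  set e := (X in sat phi X).
  (* Both tuples have the same entries, only grouped differently. *)
  have -> : e = [tuple of [tuple z; numeral N (q i);
      numeral N (\prod_(j in J) q j)] ++ c] by apply: val_inj.
  rewrite phiP; split=> [[x [y [xL yL /(congr1 val)[-> -> ->]]]]|[zL <-]] //.
  by exists z, (numeral N (q i)); split=> //; apply: numeral_le.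
split=> [[z /phi_z[]]|[z zL e]]; first by exists z.
by exists z; apply/phi_z.
Qed.
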